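(* Let $\mathcal H=TE^{\mathrm{sph}}(G)/\mathcal K$ be the effective horizontal pseudo-bundle of the spherical Milnor space, with metric $\bar g$. Assume that: (i) $\mathcal H$ has finite rank on the considered local models; (ii) $\bar g$ is strongly non-degenerate; (iii) a compatible density or integration functional has been fixed; (iv) the codifferential $\delta:\Omega^{k+1}_{\mathrm{hor}}(E^{\mathrm{sph}}(G))\to\Omega^k_{\mathrm{hor}}(E^{\mathrm{sph}}(G))$ is defined as the formal adjoint of the horizontal exterior differential $d:\Omega^k_{\mathrm{hor}}(E^{\mathrm{sph}}(G))\to\Omega^{k+1}_{\mathrm{hor}}(E^{\mathrm{sph}}(G))$, i.e. $\langle d\alpha,\beta\rangle=\langle\alpha,\delta\beta\rangle$ for admissible forms $\alpha,\beta$. Then the operator $$\Delta=d\delta+\delta d$$ acting on horizontal differential forms is well-defined and formally self-adjoint.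
   Context: Spherical Milnor space: $E^{\mathrm{sph}}(G)$ is the set of families $(x_i,g_i)_{i\in\mathbb N}$ with $x_i\in\mathbb R$ finitely supported, $\sum_i x_i^2=1$, $g_i\in G$, modulo $(x_i,g_i)\sim(x_i,g_i')$ iff $g_i=g_i'$ whenever $x_i\ne0$; it carries the final diffeology generated by its finite local models $S_I\times G^I$ ($I\subset\mathbb N$ finite, $S_I$ the unit sphere of $\mathbb R^I$). $G$ is a Lie group with an invariant Riemannian metric, $g$ is the barycentric metric given on local models by $\sum_{i\in I}dx_i^2+\sum_{i\in I}x_i^2\langle\cdot,\cdot\rangle_G^{(i)}$, $\mathcal K=\ker g\subset TE^{\mathrm{sph}}(G)$, and $\bar g$ is the non-degenerate metric induced by $g$ on $\mathcal H=TE^{\mathrm{sph}}(G)/\mathcal K$. A differential $k$-form on a diffeological space $X$ assigns to each plot $p:U\to X$ a form $\omega_p\in\Omega^k(U)$, compatibly with smooth reparametrizations. A form $\omega$ on $E^{\mathrm{sph}}(G)$ is horizontal if $\iota_v\omega=0$ for all $v\in\mathcal K$; $\Omega^k_{\mathrm{hor}}$ denotes the horizontal $k$-forms, and $d:\Omega^k_{\mathrm{hor}}\to\Omega^{k+1}_{\mathrm{hor}}$ denotes the exterior differential on them. Strongly non-degenerate means that $\flat_{\bar g}:\mathcal H\to\mathcal H^*$, $v\mapsto\bar g(v,\cdot)$, is an isomorphism; with inverse $\sharp_{\bar g}$, one sets $\langle\alpha,\beta\rangle_{\bar g}=\bar g(\sharp_{\bar g}\alpha,\sharp_{\bar g}\beta)$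 on one-forms and $\langle\alpha_1\wedge\cdots\wedge\alpha_k,\beta_1\wedge\cdots\wedge\beta_k\rangle_{\bar g}=\det(\langle\alpha_i,\beta_j\rangle_{\bar g})$. The pairing $\langle\cdot,\cdot\rangle$ on horizontal forms is the $L^2$-type pairing obtained by integrating $\langle\cdot,\cdot\rangle_{\bar g}$ against the chosen density or integration functional. Formally self-adjoint means $\langle\Delta\alpha,\beta\rangle=\langle\alpha,\Delta\beta\rangle$ for admissible horizontal forms (those for which the pairings and the adjunction are defined).
   Formalization: The exterior differential does not preserve horizontal forms when dim G > 0 (e.g. x_i θ(g_i)), so d is a partial operator: admissible forms have horizontal differential, and Δ is treated on forms α with α, dα, δα admissible. *)

(* Defs.v *)
From HB Require Import structures.
From mathcomp Require Import all_boot all_order all_algebra.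
From mathcomp Require Import finmap.
From mathcomp Require Import generic_quotient ring_quotient.
From mathcomp Require Import ring.
From mathcomp Require Import all_classical all_reals all_analysis.

Set Implicit Arguments.
Unset Strict Implicit.
Unset Printing Implicit Defensive.

Import Order.TTheory GRing.Theory Num.Theory.
Import numFieldNormedType.Exports.

Local Open Scope classical_set_scope.
Local Open Scope ring_scope.
Local Open Scope quotient_scope.

Section Smooth.
Variable R : realType.

(* C^j on the open set U, through iterated directional derivatives. *)
Fixpoint cont_diff (j n : nat) (U : set 'rV[R]_n) (f : 'rV[R]_n -> R) : Prop :=
  (forall u, U u -> {for u, continuous f}) /\
  if j is j'.+1 then
    forall v, (forall u, U u -> derivable f u v) /\ cont_diff j' U ('D_v f)
  else True.

Definition smooth_fun n (U : set 'rV[R]_n) (f : 'rV[R]_n -> R) : Prop :=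
  forall j, cont_diff j U f.

Definition smooth_map n m (U : set 'rV[R]_n) (F : 'rV[R]_n -> 'rV[R]_m) : Prop :=
  forall i, smooth_fun U (fun u => F u 0 i).

End Smooth.

Section Diffeology.
Variable R : realType.

(* P n U p : the restriction of p to U is a plot; the values of p outside U
   are irrelevant. *)
Definition plot_family (X : Type) : Type :=
  forall n : nat, set 'rV[R]_n -> ('rV[R]_n -> X) -> Prop.

Record is_diffeology (X : Type) (P : plot_family X) : Prop := {
  plot_open : forall n (U : set 'rV_n) p, P n U p -> open U;
  plot_ext : forall n (U : set 'rV_n) p q, P n U p ->
    (forall u, U u -> p u = q u) -> P n U q;
  plot_cst : forall n (U : set 'rV_n) x, open U -> P n U (fun=> x);
  plot_local : forall n (U : set 'rV_n) p, open U ->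
    (forall u, U u -> exists V, [/\ open V, V u, V `<=` U & P n V p]) ->
    P n U p;
  plot_comp : forall n m (U : set 'rV_n) (V : set 'rV_m) F p, P m V p ->
    open U -> smooth_map U F -> (forall u, U u -> V (F u)) ->
    P n U (p \o F) }.

Definition dsmooth (X Y : Type) (P : plot_family X) (Q : plot_family Y)
    (f : X -> Y) : Prop :=
  forall n (U : set 'rV_n) p, P n U p -> Q n U (f \o p).

(* Finest diffeology making every f a smooth: intersection of all of them. *)
Definition final_diffeology (T : Type) (X : T -> Type)
    (P : forall a, plot_family (X a)) (Y : Type) (f : forall a, X a -> Y) :
    plot_family Y :=
  fun n U p => forall D : plot_family Y, is_diffeology D ->
    (forall a, dsmooth (P a) D (f a)) -> D n U p.

Definition dopen (X : Type) (P : plot_family X) (A : set X) : Prop :=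
  forall n (U : set 'rV_n) p, P n U p -> open (U `&` (p @^-1` A)).

(* A k-form is written omega n U p r v: the value at r of the form attached to
   the plot p : U -> X, on the k rows of v. *)
Definition preform (X : Type) (k : nat) : Type :=
  forall n : nat, set 'rV[R]_n -> ('rV[R]_n -> X) -> 'rV[R]_n ->
    'M[R]_(k, n) -> R.

(* form_junk normalizes the values outside the domains of plots, so that forms
   are equal as soon as they agree on plots. *)
Record is_form (X : Type) (P : plot_family X) (k : nat) (omega : preform X k) :
    Prop := {
  form_junk : forall n (U : set 'rV_n) p r v, ~ (P n U p /\ U r) ->
    omega n U p r v = 0;
  form_multilinear : forall n (U : set 'rV_n) p r, P n U p -> U r ->
    forall (A B C : 'M[R]_(k, n)) i b c,
    row i A = b *: row i B + c *: row i C ->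
    row' i B = row' i A -> row' i C = row' i A ->
    omega n U p r A = b * omega n U p r B + c * omega n U p r C;
  form_alternate : forall n (U : set 'rV_n) p r, P n U p -> U r ->
    forall (A : 'M[R]_(k, n)) i j, i != j -> row i A = row j A ->
    omega n U p r A = 0;
  form_smooth : forall n (U : set 'rV_n) p v, P n U p ->
    smooth_fun U (fun r => omega n U p r v);
  form_pullback : forall n m (U : set 'rV_n) (V : set 'rV_m) F p q, P m V p ->
    open U -> smooth_map U F -> (forall u, U u -> V (F u)) ->
    (forall u, U u -> q u = p (F u)) ->
    forall u v, U u ->
    omega n U q u v = omega m V p (F u) (v *m jacobian F u) }.

(* Plotwise exterior derivative; the vectors row i v are constant fields on U,
   so no bracket term occurs. *)
Definition dform (X : Type) (P : plot_family X) (k : nat) (omega : preform X k) :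
    preform X k.+1 :=
  fun n U p r v =>
    if `[< P n U p /\ U r >] then
      \sum_(i < k.+1) (-1) ^+ i *
        'D_(row i v) (fun s => omega n U p s (row' i v)) r
    else 0.

Definition addform (X : Type) (k : nat) (a b : preform X k) : preform X k :=
  fun n U p r v => a n U p r v + b n U p r v.

End Diffeology.

Section LieGroup.
Variable R : realType.

(* A Lie group as a group with a diffeology that is a Hausdorff, second
   countable manifold and for which the operations are smooth.  A chart centered
   at each g is part of the data; T_g G is R^lg_dim through that chart. *)
Record lieGroup := LieGroup {
  lg_sort :> groupType;
  lg_dim : nat;
  lg_plot : plot_family R lg_sort;
  lg_diffeology : is_diffeology lg_plot;
  chart_dom : lg_sort -> set 'rV[R]_lg_dim;
  chart : lg_sort -> 'rV[R]_lg_dim -> lg_sort;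
  coord : lg_sort -> lg_sort -> 'rV[R]_lg_dim;
  chart_dom0 : forall g, chart_dom g 0;
  chart0 : forall g, chart g 0 = g;
  chart_plot : forall g, lg_plot (chart_dom g) (chart g);
  chartK : forall g u, chart_dom g u -> coord g (chart g u) = u;
  chart_dopen : forall g, dopen lg_plot (chart g @` chart_dom g);
  coord_smooth : forall g n (U : set 'rV_n) p, lg_plot U p ->
    (forall u, U u -> (chart g @` chart_dom g) (p u)) ->
    smooth_map U (coord g \o p);
  lg_hausdorff : forall g h, g <> h -> exists A B,
    [/\ dopen lg_plot A, dopen lg_plot B, A g, B h & A `&` B = set0];
  lg_second_countable : exists B : nat -> set lg_sort,
    (forall i, dopen lg_plot (B i)) /\
    forall A g, dopen lg_plot A -> A g -> exists i, B i g /\ B i `<=` A;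
  lg_mul_smooth : forall n (U : set 'rV_n) p q, lg_plot U p -> lg_plot U q ->
    lg_plot U (fun u => (p u * q u)%g);
  lg_inv_smooth : forall n (U : set 'rV_n) p, lg_plot U p ->
    lg_plot U (fun u => (p u)^-1%g) }.

(* gram n U p r is the Gram matrix at r of the pullback of the metric by the
   plot p : U -> G.  Invariance under left or under right translations. *)
Record invariant_metric (G : lieGroup) := InvariantMetric {
  gram : forall n, set 'rV[R]_n -> ('rV[R]_n -> G) -> 'rV[R]_n -> 'M[R]_n;
  gram_sym : forall n (U : set 'rV_n) p r, lg_plot U p -> U r ->
    (gram U p r)^T = gram U p r;
  gram_smooth : forall n (U : set 'rV_n) p i j, lg_plot U p ->
    smooth_fun U (fun r => gram U p r i j);
  gram_pullback : forall n m (U : set 'rV_n) (V : set 'rV_m) F p q,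
    lg_plot V p -> open U -> smooth_map U F -> (forall u, U u -> V (F u)) ->
    (forall u, U u -> q u = p (F u)) ->
    forall u, U u ->
    gram U q u = jacobian F u *m gram V p (F u) *m (jacobian F u)^T;
  gram_posdef : forall g u (xi : 'rV_(lg_dim G)), chart_dom g u -> xi != 0 ->
    0 < (xi *m gram (chart_dom g) (chart g) u *m xi^T) 0 0;
  gram_invariant :
    (forall h n (U : set 'rV_n) p r, lg_plot U p -> U r ->
      gram U (fun u => (h * p u)%g) r = gram U p r) \/
    (forall h n (U : set 'rV_n) p r, lg_plot U p -> U r ->
      gram U (fun u => (p u * h)%g) r = gram U p r) }.

End LieGroup.

Section MilnorSpace.
Variables (R : realType) (G : lieGroup R).

Record milnor_family := MilnorFamily {
  weight : nat -> R;
  elt : nat -> G;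
  weight_fin : finite_set [set i | weight i != 0];
  weight_unit : \sum_(i \in [set: nat]) weight i ^+ 2 = 1 }.

HB.instance Definition _ := gen_eqMixin milnor_family.
HB.instance Definition _ := gen_choiceMixin milnor_family.

Definition milnor_rel (a b : milnor_family) : bool :=
  `[< forall i, weight a i = weight b i /\
                (weight a i != 0 -> elt a i = elt b i) >].

Lemma milnor_rel_equiv : equiv_class_of milnor_rel.
Proof.
split=> [a|a b|b a c].
- exact/asboolP.
- by apply/asboolP/asboolP=> ab i; case: (ab i) => <- h; split=> // /h.
- move=> /asboolP ab /asboolP bc; apply/asboolP => i.
  case: (ab i) (bc i) => w1 e1 [w2 e2]; split; first by rewrite w1.
  by move=> w0; rewrite e1// e2// -w1.
Qed.

Canonical milnor_equiv_rel := EquivRelPack milnor_rel_equiv.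
Canonical milnor_encModRel := defaultEncModRel milnor_rel.

Definition esph := {eq_quot milnor_rel}.

Definition sqnorm n (x : 'rV[R]_n) : R := \sum_j x 0 j ^+ 2.

(* S_I x G^I, coordinates being numbered along the enumeration of I. *)
Record local_model (I : {fset nat}) := LocalModel {
  lm_wt : 'rV[R]_#|` I|;
  lm_elt : 'I_#|` I| -> G;
  lm_unit : sqnorm lm_wt = 1 }.

Definition lm_index (I : {fset nat}) (j : 'I_#|` I|) : nat := nth 0%N I j.

Section LocalModel.
Variables (I : {fset nat}) (m : local_model I).

Definition ext_weight (i : nat) : R := \sum_(j | lm_index j == i) lm_wt m 0 j.

Definition ext_elt (i : nat) : G :=
  if [pick j | @lm_index I j == i] is Some j then lm_elt m j else 1%g.

Lemma ext_weight_out i : i \notin I -> ext_weight i = 0.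
Proof.
move=> iI; rewrite /ext_weight big_pred0// => j; apply/eqP => ji.
by move: iI; rewrite -ji mem_nth.
Qed.

Lemma ext_weight_in j : ext_weight (lm_index j) = lm_wt m 0 j.
Proof.
rewrite /ext_weight (big_pred1 j)// => j' /=.
by rewrite /lm_index nth_uniq// ?fset_uniq.
Qed.

Lemma ext_weight_fin : finite_set [set i | ext_weight i != 0].
Proof.
apply: (@sub_finite_set _ _ [set` I]); last exact: finite_fset.
by move=> i /=; apply: contraNT => /ext_weight_out ->.
Qed.

Lemma ext_weight_unit : \sum_(i \in [set: nat]) ext_weight i ^+ 2 = 1.
Proof.
rewrite -(lm_unit m) (fsbigE (enum_fset I)) ?fset_uniq//; last first.
  by move=> i _ iI; rewrite ext_weight_out ?expr0n.
under eq_bigl do rewrite in_setT.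
rewrite (big_nth 0%N) big_mkord /sqnorm.
by apply: eq_bigr => j _; rewrite -ext_weight_in.
Qed.

Definition to_esph : esph :=
  \pi_esph (MilnorFamily ext_elt ext_weight_fin ext_weight_unit).

End LocalModel.

Definition lm_plot (I : {fset nat}) : plot_family R (local_model I) :=
  fun n U p => smooth_map U (fun u => lm_wt (p u)) /\
    open U /\ forall j, lg_plot U (fun u => lm_elt (p u) j).

Definition esph_plot : plot_family R esph :=
  final_diffeology lm_plot to_esph.

End MilnorSpace.

Section LinearAlgebra.
Variable R : realType.

Section QuotientModule.
Variables (V : lmodType R) (K : submodClosed V).

Definition submod_pred : V -> bool := fun v => v \in K.

Lemma submod_pred_zmod : zmod_closed submod_pred.
Proof.
split=> [|u v uK vK]; first exact: rpred0.
by rewrite -topredE /= /submod_pred -scaleN1r rpredD// rpredZ.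
Qed.

HB.instance Definition _ :=
  GRing.isZmodClosed.Build V submod_pred submod_pred_zmod.
Definition submod_zmod : zmodClosed V :=
  GRing.ZmodClosed.clone V submod_pred _.

Definition quotmod := Quotient.quot submod_zmod.
HB.instance Definition _ := GRing.Zmodule.on quotmod.
HB.instance Definition _ := EqQuotient.on quotmod.

Definition quotmod_scale (a : R) (h : quotmod) : quotmod :=
  \pi_quotmod (a *: repr h).

Lemma quotmod_eqP (x y : V) :
  reflect (\pi_quotmod x = \pi_quotmod y) (x - y \in K).
Proof. by rewrite (Quotient.idealrBE submod_zmod); apply: eqP. Qed.

Lemma quotmod_piD (x y : V) :
  \pi_quotmod (x + y) = \pi_quotmod x + \pi_quotmod y :> quotmod.
Proof. exact: (raddfD (\pi_(Quotient.quot submod_zmod))). Qed.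

Lemma quotmod_reprB (x : V) : repr (\pi_quotmod x) - x \in K.
Proof. by apply/quotmod_eqP; rewrite reprK. Qed.

Lemma quotmod_piZ a (x : V) : \pi_quotmod (a *: x) = quotmod_scale a (\pi x).
Proof.
apply/esym/quotmod_eqP; rewrite -scalerBr rpredZ//.
exact: quotmod_reprB.
Qed.

Lemma quotmodW (P : quotmod -> Prop) :
  (forall x, P (\pi_quotmod x)) -> forall h, P h.
Proof. by move=> hP h; rewrite -[h]reprK. Qed.

Lemma quotmod_scaleA a b (h : quotmod) :
  quotmod_scale a (quotmod_scale b h) = quotmod_scale (a * b) h.
Proof.
elim/quotmodW: h => x.
by rewrite -(quotmod_piZ b x) -(quotmod_piZ a) -(quotmod_piZ (a * b)) scalerA.
Qed.

Lemma quotmod_scale1 : left_id 1 quotmod_scale.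
Proof. by elim/quotmodW => x; rewrite -quotmod_piZ scale1r. Qed.

Lemma quotmod_scaleDr : right_distributive quotmod_scale +%R.
Proof.
move=> a; elim/quotmodW => x; elim/quotmodW => y.
rewrite -quotmod_piD -(quotmod_piZ a x) -(quotmod_piZ a y).
by rewrite -(quotmod_piZ a) scalerDr quotmod_piD.
Qed.

Lemma quotmod_scaleDl h : {morph quotmod_scale^~ h : a b / a + b}.
Proof.
move=> a b; elim/quotmodW: h => x.
rewrite -(quotmod_piZ a x) -(quotmod_piZ b x) -(quotmod_piZ (a + b)).
by rewrite scalerDl quotmod_piD.
Qed.

HB.instance Definition _ := GRing.Zmodule_isLmodule.Build R quotmod
  quotmod_scaleA quotmod_scale1 quotmod_scaleDr quotmod_scaleDl.

End QuotientModule.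

Definition wedge (V : lmodType R) k (a : 'I_k -> {scalar V}) :
    ('I_k -> V) -> R :=
  fun h => \det (\matrix_(i, j) a i (h j)).

(* Bilinear extension to all k-forms of
   <a_1 ^ ... ^ a_k, b_1 ^ ... ^ b_k> = det <a_i, b_j>. *)
Definition ext_pairing (V : lmodType R) (P : {scalar V} -> {scalar V} -> R)
    k (alpha beta : ('I_k -> V) -> R) : R :=
  xget 0 [set t | exists p q (c : 'I_p -> R) (a : 'I_p -> 'I_k -> {scalar V})
                         (d : 'I_q -> R) (b : 'I_q -> 'I_k -> {scalar V}),
    [/\ forall h, alpha h = \sum_s c s * wedge (a s) h,
        forall h, beta h = \sum_s d s * wedge (b s) h &
        t = \sum_s \sum_s' c s * d s' *
              \det (\matrix_(i, j) P (a s i) (b s' j))]].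

End LinearAlgebra.

Section Horizontal.
Variables (R : realType) (G : lieGroup R) (met : invariant_metric G).

Section Fiber.
Variables (I : {fset nat}) (m : local_model G I).

Definition lm_dim := (#|` I| + #|` I| * lg_dim G)%N.

(* A vector v of R^lm_dim is split into its R^I component (lsubmx v) and its
   T_(g_j) G components (the rows of vec_mx (rsubmx v)). *)
Definition gcomp (v : 'rV[R]_lm_dim) (j : 'I_#|` I|) : 'rV[R]_(lg_dim G) :=
  row j (vec_mx (rsubmx v)).

Lemma gcompP a v w j : gcomp (a *: v + w) j = a *: gcomp v j + gcomp w j.
Proof. by rewrite /gcomp !linearP. Qed.

(* T_m (S_I x G^I): T_x S_I is the orthogonal of x. *)
Definition tangent_space : {vspace 'rV[R]_lm_dim} :=
  lker (linfun (mulmxr (lm_wt m)^T \o lsubmx : 'rV[R]_lm_dim -> 'M[R]_1)).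

Definition tangent := subvs_of tangent_space.

Definition gram_at (g : G) : 'M[R]_(lg_dim G) :=
  gram met (chart_dom g) (chart g) 0.

Definition bary_metric (v w : tangent) : R :=
  \sum_j lsubmx (vsval v) 0 j * lsubmx (vsval w) 0 j +
  \sum_j lm_wt m 0 j ^+ 2 *
    (gcomp (vsval v) j *m gram_at (lm_elt m j) *m (gcomp (vsval w) j)^T) 0 0.

Definition bary_ker : tangent -> bool :=
  fun v => `[< forall w, bary_metric v w = 0 >].

Lemma bary_metricC v w : bary_metric v w = bary_metric w v.
Proof.
rewrite /bary_metric; congr (_ + _); apply: eq_bigr => j _.
  by rewrite mulrC.
congr (_ * _); set w' := vsval w; set v' := vsval v.
transitivity ((gcomp v' j *m gram_at (lm_elt m j) *m (gcomp w' j)^T)^T 0 0).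
  by rewrite [RHS]mxE.
rewrite !trmx_mul trmxK /gram_at gram_sym ?mulmxA//; first exact: chart_plot.
exact: chart_dom0.
Qed.

Lemma bary_metric_linear v a w w' :
  bary_metric v (a *: w + w') = a * bary_metric v w + bary_metric v w'.
Proof.
rewrite /bary_metric mulrDr addrACA !mulr_sumr -!big_split /=.
apply: eq_bigr => j _.
by rewrite linearP /= gcompP linearP /= mulmxDr -scalemxAr !mxE; ring.
Qed.

Lemma bary_ker_submod : submod_closed bary_ker.
Proof.
split=> [|a v v' /asboolP kv /asboolP kv'].
  apply/asboolP => w; rewrite bary_metricC.
  have := bary_metric_linear w (-1) 0 0.
  by rewrite scaler0 addr0 mulN1r addNr.
apply/asboolP => w; rewrite bary_metricC bary_metric_linear.
by rewrite bary_metricC kv bary_metricC kv' mulr0 addr0.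
Qed.

HB.instance Definition _ :=
  GRing.isSubmodClosed.Build R tangent bary_ker bary_ker_submod.

(* Fiber of the horizontal pseudo-bundle, T_m / K_m with K_m the kernel of
   the barycentric metric. *)
Definition hspace := quotmod (GRing.SubmodClosed.clone R tangent bary_ker _).
HB.instance Definition _ := GRing.Lmodule.on hspace.
HB.instance Definition _ := Quotient.on hspace.

Definition gbar (h h' : hspace) : R := bary_metric (repr h) (repr h').

Lemma bary_metric_repr v w :
  bary_metric v (repr (\pi_hspace w)) = bary_metric v w.
Proof.
have /asboolP /(_ v) kv : bary_ker (repr (\pi_hspace w) - w).
  exact: quotmod_reprB.
have := bary_metric_linear v 1 (repr (\pi_hspace w) - w) w.
by rewrite scale1r subrK [X in _ * X]bary_metricC kv mulr0 add0r.
Qed.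

Lemma gbar_scalar h : scalar (gbar h).
Proof.
move=> a x y; rewrite /gbar -bary_metric_linear.
have -> : a *: x + y = \pi_hspace (a *: repr x + repr y).
  by rewrite quotmod_piD quotmod_piZ !reprK.
exact: bary_metric_repr.
Qed.

HB.instance Definition _ h :=
  GRing.isLinear.Build R hspace R *%R (gbar h) (gbar_scalar h).

Definition flat (h : hspace) : {scalar hspace} :=
  GRing.Linear.clone R hspace R *%R (gbar h) _.

Definition sharp (a : {scalar hspace}) : hspace := xget 0 [set h | flat h = a].

Definition inner_dual (a b : {scalar hspace}) : R := gbar (sharp a) (sharp b).

Lemma sphere_retr_unit (y : 'rV[R]_#|` I|) :
  sqnorm (if sqnorm y == 0 then lm_wt m
          else (Num.sqrt (sqnorm y))^-1 *: y) = 1.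
Proof.
case: eqP => [_|/eqP y0]; first exact: lm_unit.
rewrite /sqnorm; under eq_bigr do rewrite mxE exprMn.
rewrite -mulr_sumr -/(sqnorm y) exprVn sqr_sqrtr ?mulVf//.
by apply: sumr_ge0 => j _; rewrite sqr_ge0.
Qed.

(* Submersion ((x + y)/|x + y|, (chart at g_j)(u_j)_j) of an open neighborhood
   of 0 in R^lm_dim onto one of m = (x, g) in S_I x G^I; its differential at 0
   is the identity on T_m. *)
Definition lm_param_dom : set 'rV[R]_lm_dim :=
  [set w | sqnorm (lm_wt m + lsubmx w) != 0 /\
           forall j, chart_dom (lm_elt m j) (gcomp w j)].

Definition lm_param (w : 'rV[R]_lm_dim) : local_model G I :=
  LocalModel (fun j => chart (lm_elt m j) (gcomp w j))
             (sphere_retr_unit (lm_wt m + lsubmx w)).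

(* Value at m of the pullback of omega to S_I x G^I. *)
Definition form_at k (omega : preform R (esph G) k) (v : 'I_k -> tangent) : R :=
  omega _ lm_param_dom (@to_esph R G I \o lm_param) 0
    (\matrix_(i < k) vsval (v i)).

(* The form induced on H_m by a horizontal form. *)
Definition form_on_hspace k (omega : preform R (esph G) k)
    (h : 'I_k -> hspace) : R :=
  form_at omega (fun i => repr (h i)).

End Fiber.

Definition finite_rank (I : {fset nat}) : Prop :=
  exists r (e : forall m : local_model G I, 'I_r -> hspace m),
    forall m (h : hspace m), exists c : 'I_r -> R, h = \sum_i c i *: e m i.

Definition strongly_nondegenerate (I : {fset nat}) : Prop :=
  forall m : local_model G I, bijective (@flat I m).

Definition horizontal k (omega : preform R (esph G) k) : Prop :=
  is_form (@esph_plot R G) omega /\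
  forall (I : {fset nat}) (m : local_model G I) (v : 'I_k -> tangent m) i,
    bary_ker (v i) -> form_at omega v = 0.

Section Pairing.
Variables (J : Type) (I_ : J -> {fset nat}).

(* The family I_ lists the considered local models.  The integrand of the
   pairing depends on the local model and on the representative (x, g) chosen
   on it, so functionals act on families of functions on the S_I x G^I. *)
Definition lm_functions := forall j, local_model G (I_ j) -> R.

(* A density gives the functional integrating against it, defined on the
   integrable families.  Compatibility is with the equivalence relation that
   defines the Milnor space: changes of representatives leave the value alone. *)
Record integration := Integration {
  int_dom : set lm_functions;
  int_val : lm_functions -> R;
  int_dom0 : int_dom (fun _ _ => 0);
  int_dom_linear : forall a f g, int_dom f -> int_dom g ->
    int_dom (fun j m => a * f j m + g j m);
  int_val_linear : forall a f g, int_dom f -> int_dom g ->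
    int_val (fun j m => a * f j m + g j m) = a * int_val f + int_val g;
  int_compatible : forall (tau : forall j, local_model G (I_ j) ->
                                           local_model G (I_ j)) f,
    (forall j m, to_esph (tau j m) = to_esph m) ->
    int_dom f -> int_dom (fun j m => f j (tau j m)) ->
    int_val (fun j m => f j (tau j m)) = int_val f }.

Variable mu : integration.

Definition integrand k (alpha beta : preform R (esph G) k) : lm_functions :=
  fun j m => ext_pairing (@inner_dual _ m)
    (fun h : 'I_k -> hspace m => form_on_hspace alpha h)
    (fun h : 'I_k -> hspace m => form_on_hspace beta h).

Definition paired k (alpha beta : preform R (esph G) k) : Prop :=
  int_dom mu (integrand alpha beta).

Definition pairing k (alpha beta : preform R (esph G) k) : R :=
  int_val mu (integrand alpha beta).

Definition esph_d k (omega : preform R (esph G) k) : preform R (esph G) k.+1 :=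
  dform (@esph_plot R G) omega.

(* A k is the class of admissible k-forms.  The exterior derivative of a
   horizontal form need not be horizontal: for theta a left-invariant 1-form on
   G, x_i * theta(g_i) is horizontal, while its differential contains
   dx_i ^ theta(g_i), not killed by the vectors of T_(g_i) G at x_i = 0.  So
   d : Omega_hor -> Omega_hor is a partial operator, and lying in its domain is
   part of admissibility. *)
Definition admissible (A : forall k, set (preform R (esph G) k)) : Prop :=
  forall k alpha, A k alpha -> horizontal alpha /\ horizontal (esph_d alpha).

Definition formal_adjoint (A : forall k, set (preform R (esph G) k))
    (delta : forall k, preform R (esph G) k.+1 -> preform R (esph G) k) :
    Prop :=
  forall k alpha beta, A k alpha -> A k.+1 beta ->
    [/\ paired (esph_d alpha) beta, paired alpha (delta k beta) &
        pairing (esph_d alpha) beta = pairing alpha (delta k beta)].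

End Pairing.

Section Laplacian.
Variables (delta : forall k, preform R (esph G) k.+1 -> preform R (esph G) k).

(* In degree 0 the term d delta is zero. *)
Definition laplacian k : preform R (esph G) k -> preform R (esph G) k :=
  match k with
  | 0 => fun alpha => delta (esph_d alpha)
  | k'.+1 => fun alpha =>
      addform (esph_d (delta alpha)) (delta (esph_d alpha))
  end.

(* Admissible forms to which both d delta and delta d apply. *)
Definition laplacian_dom (A : forall k, set (preform R (esph G) k)) k :
    set (preform R (esph G) k) :=
  match k with
  | 0 => [set alpha | A 0 alpha /\ A 1 (esph_d alpha)]
  | k'.+1 => [set alpha | [/\ A k'.+1 alpha, A k'.+2 (esph_d alpha) &
                              A k' (delta alpha)]]
  end.

End Laplacian.
End Horizontal.

(* Main.v *)
Require Import Defs.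
From mathcomp Require Import all_boot all_order all_algebra perm.
From mathcomp Require Import finmap generic_quotient.
From mathcomp Require Import ring.
From mathcomp Require Import all_classical all_reals all_analysis.

(** The operator is built so that each of its two terms moves across the pairing
    by the adjunction alone:
<<
    <d delta a, b> = <delta a, delta b>   and   <delta d a, b> = <d a, d b>.
>>
    Summed, they show that <Delta a, b> equals the Dirichlet form
    <delta a, delta b> + <d a, d b> ([pairing_laplacian]), which is symmetric in
    a and b.  Two properties of the pairing are consumed on the way: symmetry,
    because the adjunction is only given with d on the left, and additivity in
    the first argument, to split Delta a.  They are where finite rank and
    strong non-degeneracy enter.

    Fibrewise the metric on forms is prescribed on products of covectors by a
    determinant, then extended to sums of such products, and the value might a
    priori depend on the chosen sums.  When flat is invertible,
    <a_i, b_j> = a_i (sharp b_j), so that the determinant is the value of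
    a_1 ^ ... ^ a_k at the vectors sharp b_j.  The metric of alpha with
    sum_s d_s b_s1 ^ ... ^ b_sk is therefore
    sum_s d_s alpha (sharp b_s1, ..., sharp b_sk), which mentions no
    decomposition of alpha; symmetry of the metric on covectors removes the
    dependence on the decomposition of beta as well ([ext_pairingE]).  Additivity
    is visible on this formula and symmetry is [sharp_reciprocity].

    It remains that horizontal forms do induce sums of products of covectors on
    the fibres.  A horizontal form descends to a multilinear alternating form on
    H_m, since changing a representative by an element of the kernel does not
    change its value.  Finite rank gives a finite frame with dual covectors
    ([dual_frame]); expanding along the frame writes the form as a sum of tensor
    products of covectors, and antisymmetrizing turns these into wedge products
    ([alternating_decomposable]).

    That Delta a is again horizontal is immediate except that horizontal forms
    must be closed under sums, where smoothness of a sum of smooth functions on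
    an open set has to be checked ([is_form_addform]). *)

Set Implicit Arguments.
Unset Strict Implicit.
Unset Printing Implicit Defensive.

Import Order.TTheory GRing.Theory Num.Theory.
Import numFieldNormedType.Exports.

Local Open Scope classical_set_scope.
Local Open Scope ring_scope.
Local Open Scope quotient_scope.

(** * Sums of differential forms *)

Section SmoothSums.
Variables (R : realType) (n : nat) (U : set 'rV[R]_n).
Hypothesis openU : open U.

Lemma eq_on_open_near (f g : 'rV[R]_n -> R) u :
  (forall w, U w -> f w = g w) -> U u -> \forall w \near u, f w = g w.
Proof.
move=> fg Uu; near=> w; apply: fg; near: w.
exact: open_nbhs_nbhs.
Unshelve. all: by end_near. Qed.

(** Directional derivatives of functions that agree on [U] agree on [U] only, so
    an induction on the order of differentiability needs the predicate to be
    insensitive to the values outside [U]. *)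
Lemma eq_cont_diff j (f g : 'rV[R]_n -> R) :
  (forall w, U w -> f w = g w) -> cont_diff j U f -> cont_diff j U g.
Proof.
have cont (f' g' : 'rV[R]_n -> R) : (forall w, U w -> f' w = g' w) ->
    (forall u, U u -> {for u, continuous f'}) ->
    forall u, U u -> {for u, continuous g'}.
  move=> fg cf u Uu; move: (cf u Uu).
  rewrite /prop_for /continuous_at (fg u Uu).
  apply: cvg_trans; exact: (near_eq_cvg (eq_on_open_near fg Uu)).
elim: j f g => [|j IHj] f g fg /= [cf df]; split=> //; try exact: cont cf.
move=> v; have [dfv cdf] := df v; split=> [u Uu|].
    apply: near_eq_derivable (dfv u Uu); exact: eq_on_open_near.
  apply: IHj cdf => u Uu; apply: near_eq_derive; exact: eq_on_open_near.
Qed.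

Lemma cont_diffD j (f g : 'rV[R]_n -> R) :
  cont_diff j U f -> cont_diff j U g -> cont_diff j U (fun w => f w + g w).
Proof.
elim: j f g => [|j IHj] f g /= [cf df] [cg dg]; split=> //.
- by move=> u Uu; apply: continuousD; [exact: cf|exact: cg].
- by move=> u Uu; apply: continuousD; [exact: cf|exact: cg].
- move=> v; have [dfv cdf] := df v; have [dgv cdg] := dg v; split=> [u Uu|].
    by apply: derivableD; [exact: dfv|exact: dgv].
  apply: eq_cont_diff (IHj _ _ cdf cdg) => u Uu.
  by rewrite -deriveD//; [exact: dfv|exact: dgv].
Qed.

Lemma smooth_funD (f g : 'rV[R]_n -> R) :
  smooth_fun U f -> smooth_fun U g -> smooth_fun U (fun w => f w + g w).
Proof. by move=> sf sg j; apply: cont_diffD. Qed.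

End SmoothSums.

Lemma is_form_addform (R : realType) (X : Type) (P : plot_family R X) k
    (a b : preform R X k) :
  (forall n (U : set 'rV_n) p, P n U p -> open U) ->
  is_form P a -> is_form P b -> is_form P (addform a b).
Proof.
move=> hP [ja ma aa sa pa] [jb mb ab sb pb]; split.
- by move=> n U p r v h; rewrite /addform ja// jb// addr0.
- move=> n U p r Pp Ur A B C i b0 c hA hB hC; rewrite /addform.
  by rewrite (ma _ _ _ _ Pp Ur _ _ _ _ _ _ hA hB hC)
             (mb _ _ _ _ Pp Ur _ _ _ _ _ _ hA hB hC); ring.
- move=> n U p r Pp Ur A i j ij Aij.
  by rewrite /addform (aa _ _ _ _ Pp Ur _ _ _ ij Aij)
             (ab _ _ _ _ Pp Ur _ _ _ ij Aij) addr0.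
- move=> n U p v Pp; apply: smooth_funD; [exact: hP Pp| |].
    exact: sa. exact: sb.
- move=> n m U V F p q Pp oU sF UV qp u v Uu; rewrite /addform.
  by rewrite (pa _ _ _ _ _ _ _ Pp oU sF UV qp)//
             (pb _ _ _ _ _ _ _ Pp oU sF UV qp).
Qed.

(** * Alternating forms as sums of wedge products *)

Section MultilinearAlternating.
Variables (R : realType) (V : lmodType R).

(** Linearity in the [i]-th argument is expressed by comparing three families
    that differ at [i] only, which avoids an update operation. *)
Definition multilinear k (alpha : ('I_k -> V) -> R) : Prop :=
  forall i b c (h h' h'' : 'I_k -> V), h i = b *: h' i + c *: h'' i ->
    (forall j, j != i -> h' j = h j) -> (forall j, j != i -> h'' j = h j) ->
    alpha h = b * alpha h' + c * alpha h''.

Definition alternating k (alpha : ('I_k -> V) -> R) : Prop :=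
  forall h i j, i != j -> h i = h j -> alpha h = 0.

(** The forms to which the defining condition of [ext_pairing] applies. *)
Definition decomposable k (alpha : ('I_k -> V) -> R) : Prop :=
  exists p (c : 'I_p -> R) (a : 'I_p -> 'I_k -> {scalar V}),
    forall h, alpha h = \sum_s c s * wedge (a s) h.

Section Antisymmetry.
Variables (k : nat) (alpha : ('I_k -> V) -> R).
Hypotheses (lin : multilinear alpha) (alt : alternating alpha).

(** Expand [alpha (.., h i + h j, .., h i + h j, ..) = 0]. *)
Lemma alternating_tperm (h : 'I_k -> V) i j :
  i != j -> alpha (h \o tperm i j) = - alpha h.
Proof.
move=> ij.
pose put x y l := if l == i then x else if l == j then y else h l.
have putDl x x' y : alpha (put (x + x') y) = alpha (put x y) + alpha (put x' y).
  rewrite (@lin i 1 1 _ (put x y) (put x' y)) ?mul1r//.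
  - by rewrite /put eqxx !scale1r.
  - by move=> l /negPf li; rewrite /put li.
  - by move=> l /negPf li; rewrite /put li.
have putDr x y y' : alpha (put x (y + y')) = alpha (put x y) + alpha (put x y').
  rewrite (@lin j 1 1 _ (put x y) (put x y')) ?mul1r//.
  - by rewrite /put eq_sym (negPf ij) eqxx !scale1r.
  - by move=> l /negPf lj; rewrite /put lj.
  - by move=> l /negPf lj; rewrite /put lj.
have put0 x : alpha (put x x) = 0.
  by apply: (alt ij); rewrite /put eqxx eq_sym (negPf ij) eqxx.
have := put0 (h i + h j).
rewrite putDl !putDr !put0 add0r addr0 addrC.
move=> /eqP; rewrite addr_eq0 => /eqP E.
rewrite (_ : h \o _ = put (h j) (h i)); last first.
  apply/funext => l /=; rewrite /put.
  case: tpermP => [->|->|/eqP/negPf -> /eqP/negPf ->//].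
    by rewrite eqxx.
  by rewrite eq_sym (negPf ij) eqxx.
rewrite E; congr (- alpha _); apply/funext => l; rewrite /put.
by case: eqP => [->//|_]; case: eqP => [->|].
Qed.

Lemma alternating_perm (h : 'I_k -> V) (s : 'S_k) :
  alpha (h \o s) = (-1) ^+ s * alpha h.
Proof.
have [ts -> {s}] := prod_tpermP s.
elim: ts h => [|[i j] ts IHts] h /=.
  move=> _; rewrite big_nil odd_perm1 expr0 mul1r; congr alpha.
  by apply/funext => l /=; rewrite perm1.
case/andP=> ij /IHts {}IHts; rewrite big_cons odd_mul_tperm ij signr_addb.
rewrite expr1 -mulrA -IHts mulN1r -(alternating_tperm _ ij); congr alpha.
by apply/funext => l /=; rewrite permM.
Qed.

End Antisymmetry.

Section Frame.
Variables (r : nat) (e : 'I_r -> V) (c : 'I_r -> {scalar V}).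
Hypothesis frameE : forall h, h = \sum_l c l h *: e l.

Definition fcons (T : Type) k (x : T) (h : 'I_k -> T) : 'I_k.+1 -> T :=
  fun i => if unlift ord0 i is Some j then h j else x.

Lemma multilinear_sum k (alpha : ('I_k.+1 -> V) -> R) (h : 'I_k -> V)
    T (s : seq T) (x : T -> R) (v : T -> V) : multilinear alpha ->
  alpha (fcons (\sum_(l <- s) x l *: v l) h) =
  \sum_(l <- s) x l * alpha (fcons (v l) h).
Proof.
move=> lin; have fcons0 y : fcons y h ord0 = y by rewrite /fcons unlift_none.
have fconsN y z i : i != ord0 -> fcons y h i = fcons z h i.
  by rewrite /fcons; case: unliftP => // ->; rewrite eqxx.
elim: s => [|l s IHs]; last first.
  rewrite !big_cons -IHs -[alpha (fcons (\sum_(l <- s) _) h)]mul1r.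
  apply: (lin ord0); rewrite ?fcons0 ?scale1r//; exact: fconsN.
rewrite !big_nil (lin ord0 0 0 _ (fcons 0 h) (fcons 0 h)) ?mul0r ?addr0//.
by rewrite !fcons0 !scale0r addr0.
Qed.

(** Induction on the degree: expanding the first argument along the frame leaves,
    for each frame vector, a multilinear form in the remaining arguments. *)
Lemma multilinear_tensors k (alpha : ('I_k -> V) -> R) : multilinear alpha ->
  exists s : seq (R * ('I_k -> {scalar V})),
    forall h, alpha h = \sum_(x <- s) x.1 * \prod_i x.2 i (h i).
Proof.
elim: k alpha => [|k IHk] alpha lin.
  have a : 'I_0 -> {scalar V} by case.
  exists [:: (alpha (fun=> 0), a)] => h.
  rewrite big_seq1 big_ord0 mulr1; congr alpha.
  by apply/funext => -[].
have /(_ _)/cid-/all_sig[S hS] l : exists s : seq (R * ('I_k -> {scalar V})),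
    forall h, alpha (fcons (e l) h) = \sum_(x <- s) x.1 * \prod_i x.2 i (h i).
  apply: IHk => i b b' h h' h'' hi h'i h''i; apply: (lin (lift ord0 i)).
  - by rewrite /fcons liftK.
  - move=> j; rewrite /fcons; case: unliftP => // j' -> ne; apply: h'i.
    by apply: contraNneq ne => ->.
  - move=> j; rewrite /fcons; case: unliftP => // j' -> ne; apply: h''i.
    by apply: contraNneq ne => ->.
exists [seq (x.1, fcons (c l) x.2) | l <- enum 'I_r, x <- S l] => h.
rewrite big_allpairs_dep /=.
have -> : h = fcons (\sum_(l <- enum 'I_r) c l (h ord0) *: e l)
                    (h \o lift ord0).
  rewrite big_enum -frameE; apply/funext => i.
  by rewrite /fcons; case: unliftP => [j|] ->.
rewrite multilinear_sum//; apply: eq_bigr => l _.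
rewrite hS mulr_sumr; apply: eq_bigr => x _.
rewrite big_ord_recl /= mulrCA /fcons unlift_none big_enum -frameE.
by congr (_ * (_ * _)); apply: eq_bigr => i _; rewrite liftK.
Qed.

(** An alternating form is [1 / k!] times its signed sum over permutations of the
    arguments, and the signed sum of a tensor product of covectors is the Leibniz
    formula for the determinant defining their wedge product. *)
Lemma alternating_decomposable k (alpha : ('I_k -> V) -> R) :
  multilinear alpha -> alternating alpha -> decomposable alpha.
Proof.
move=> lin alt; have [t ht] := multilinear_tensors lin.
pose y s := tnth (in_tuple t) s.
exists (size t), (fun s => (k`!%:R)^-1 * (y s).1), (fun s => (y s).2) => h.
have k0 : k`!%:R != 0 :> R by rewrite pnatr_eq0 -lt0n fact_gt0.
apply: (mulfI k0); rewrite mulr_sumr.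
transitivity (\sum_(s : 'S_k) (-1) ^+ s * alpha (h \o s)).
  under eq_bigr do
    rewrite (alternating_perm lin alt) mulrA -signr_addb addbb mul1r.
  by rewrite sumr_const card_Sn mulr_natl.
under eq_bigr do rewrite ht big_tnth mulr_sumr.
rewrite exchange_big; apply: eq_bigr => s _ /=.
rewrite !mulrA divff// mul1r /wedge /determinant mulr_sumr.
apply: eq_bigr => u _; rewrite mulrCA; congr (_ * (_ * _)).
by apply: eq_bigr => i _; rewrite mxE.
Qed.

End Frame.
End MultilinearAlternating.

(** * The metric on forms does not depend on decompositions *)

Section ExtPairing.
Variables (R : realType) (V : lmodType R).

Variables (P : {scalar V} -> {scalar V} -> R) (sh : {scalar V} -> V).
Hypotheses (PE : forall a b, P a b = a (sh b)) (PC : forall a b, P a b = P b a).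

Section Degree.
Variable k : nat.
Implicit Types alpha beta : ('I_k -> V) -> R.

Lemma det_pairing (a b : 'I_k -> {scalar V}) :
  \det (\matrix_(i, j) P (a i) (b j)) = wedge a (sh \o b).
Proof. by congr (\det _); apply/matrixP => i j; rewrite !mxE PE. Qed.

Lemma wedge_sharpC (a b : 'I_k -> {scalar V}) :
  wedge a (sh \o b) = wedge b (sh \o a).
Proof.
rewrite -!det_pairing -det_tr; congr (\det _).
by apply/matrixP => i j; rewrite !mxE PC.
Qed.

(** The left side ignores how [alpha] is decomposed and the right side ignores how
    [beta] is: this is what makes the metric on forms well defined. *)
Lemma sharp_reciprocity alpha beta p q (c : 'I_p -> R)
    (a : 'I_p -> 'I_k -> {scalar V}) (d : 'I_q -> R)
    (b : 'I_q -> 'I_k -> {scalar V}) :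
  (forall h, alpha h = \sum_s c s * wedge (a s) h) ->
  (forall h, beta h = \sum_s d s * wedge (b s) h) ->
  \sum_s d s * alpha (sh \o b s) = \sum_s c s * beta (sh \o a s).
Proof.
move=> alphaE betaE.
under eq_bigr do rewrite alphaE mulr_sumr.
rewrite exchange_big; apply: eq_bigr => s _ /=.
rewrite betaE mulr_sumr; apply: eq_bigr => t _.
by rewrite wedge_sharpC mulrCA.
Qed.

(** The decompositions selected by [ext_pairing] are arbitrary; reciprocity
    exchanges first the one of [beta], then the one of [alpha]. *)
Lemma ext_pairingE alpha beta q (d : 'I_q -> R)
    (b : 'I_q -> 'I_k -> {scalar V}) :
  decomposable alpha -> (forall h, beta h = \sum_s d s * wedge (b s) h) ->
  ext_pairing P alpha beta = \sum_s d s * alpha (sh \o b s).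
Proof.
move=> [p [c [a alphaE]]] betaE; rewrite /ext_pairing.
case: xgetP => [t _|/(_ (\sum_s \sum_s' c s * d s' *
    \det (\matrix_(i, j) P (a s i) (b s' j))))]; last first.
  by case; exists p, q, c, a, d, b.
move=> [p' [q' [c' [a' [d' [b' [alphaE' betaE' ->]]]]]]].
rewrite (sharp_reciprocity alphaE' betaE).
apply: eq_bigr => s _; rewrite betaE' mulr_sumr; apply: eq_bigr => s' _.
by rewrite -mulrA det_pairing wedge_sharpC.
Qed.

Lemma ext_pairingC alpha beta :
  decomposable alpha -> decomposable beta ->
  ext_pairing P alpha beta = ext_pairing P beta alpha.
Proof.
move=> da db; have [p [c [a alphaE]]] := da; have [q [d [b betaE]]] := db.
rewrite (ext_pairingE da betaE) (ext_pairingE db alphaE).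
exact: sharp_reciprocity.
Qed.

Lemma ext_pairingDl alpha alpha' beta :
  decomposable alpha -> decomposable alpha' ->
  decomposable (fun h => alpha h + alpha' h) -> decomposable beta ->
  ext_pairing P (fun h => alpha h + alpha' h) beta =
  ext_pairing P alpha beta + ext_pairing P alpha' beta.
Proof.
move=> da da' daa' [q [d [b betaE]]].
rewrite (ext_pairingE daa' betaE) (ext_pairingE da betaE).
by rewrite (ext_pairingE da' betaE) -big_split; apply: eq_bigr => s _;
  rewrite mulrDr.
Qed.

End Degree.
End ExtPairing.

(** * Horizontal forms on the fibres *)

Section HorizontalForms.
Variables (R : realType) (G : lieGroup R) (met : invariant_metric G).

(** The open sets with all maps form a diffeology, one of those intersected in the
    final diffeology. *)
Lemma esph_plot_open n (U : set 'rV[R]_n) p : esph_plot (G := G) U p -> open U.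
Proof.
move=> /(_ (fun n U _ => open U)); apply; first by split.
by move=> I n' U' q [_ []].
Qed.

Lemma horizontal_addform k (a b : preform R (esph G) k) :
  horizontal met a -> horizontal met b -> horizontal met (addform a b).
Proof.
move=> [fa ha] [fb hb]; split.
  by apply: is_form_addform fa fb => n U p; exact: esph_plot_open.
move=> I m v i kv; rewrite /form_at /addform.
move: (ha _ _ _ _ kv) (hb _ _ _ _ kv).
by rewrite /form_at => -> ->; rewrite addr0.
Qed.

Section Fiber.
Variables (I : {fset nat}) (m : local_model G I).

(** The axioms of forms speak of plots only; if the local parametrization at [m]
    failed to be one, forms would take their default value 0 there. *)
Lemma form_at_plot k (omega : preform R (esph G) k) :
  is_form (@esph_plot R G) omega ->
  (esph_plot (@lm_param_dom _ _ _ m) (@to_esph R G I \o lm_param m) /\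
   lm_param_dom m 0) \/
  forall v : 'I_k -> tangent m, form_at omega v = 0.
Proof.
move=> fo; set A := (A in A \/ _).
have [h|h] := pselect A; [by left|right=> v].
exact: (form_junk fo).
Qed.

Lemma form_at_multilinear k (omega : preform R (esph G) k) :
  is_form (@esph_plot R G) omega ->
  multilinear (fun v : 'I_k -> tangent m => form_at omega v).
Proof.
move=> fo i b c h h' h'' hi h'j h''j.
have [[pl dom0]|om0] := form_at_plot fo; last by rewrite !om0 !mulr0 addr0.
apply: (form_multilinear fo pl dom0 (i := i)).
- by rewrite !rowK hi linearP linearZ.
- by apply/matrixP => x y; rewrite !mxE h'j// eq_sym neq_lift.
- by apply/matrixP => x y; rewrite !mxE h''j// eq_sym neq_lift.
Qed.

Lemma form_at_alternating k (omega : preform R (esph G) k) :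
  is_form (@esph_plot R G) omega ->
  alternating (fun v : 'I_k -> tangent m => form_at omega v).
Proof.
move=> fo h i j ij hij.
have [[pl dom0]|om0] := form_at_plot fo; last by rewrite om0.
by apply: (form_alternate fo pl dom0 ij); rewrite !rowK hij.
Qed.

(** Representatives in [hspace] are not chosen linearly: that of a linear
    combination differs from the combination of the representatives by an element
    of the kernel, on which a horizontal form vanishes. *)
Lemma form_on_hspace_multilinear k (omega : preform R (esph G) k) :
  horizontal met omega ->
  multilinear (fun h : 'I_k -> hspace met m => form_on_hspace omega h).
Proof.
move=> [fo ho] i b c h h' h'' hi h'j h''j; rewrite /form_on_hspace.
have lin := form_at_multilinear fo.
set v := fun j => repr (h j).
pose w := b *: repr (h' i) + c *: repr (h'' i).
pose put x j := if j == i then x else v j.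
have putN x j : j != i -> put x j = v j by move=> /negPf ji; rewrite /put ji.
have kvw : bary_ker met (v i - w).
  have -> : v i = repr (\pi_(hspace met m) w).
    by rewrite /v hi /w quotmod_piD !quotmod_piZ !reprK.
  exact: quotmod_reprB.
rewrite (lin i 1 1 v (put w) (put (v i - w))) ?mul1r; last 3 first.
- by rewrite /put eqxx !scale1r addrC subrK.
- exact: putN.
- exact: putN.
rewrite [X in _ + X](ho _ _ _ i) ?addr0; last by rewrite /put eqxx.
apply: (lin i); first by rewrite /put eqxx.
- by move=> j ji; rewrite putN// h'j.
- by move=> j ji; rewrite putN// h''j.
Qed.

Lemma form_on_hspace_alternating k (omega : preform R (esph G) k) :
  horizontal met omega ->
  alternating (fun h : 'I_k -> hspace met m => form_on_hspace omega h).
Proof.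
move=> [fo _] h i j ij hij; apply: (form_at_alternating fo ij).
by rewrite hij.
Qed.

Lemma gbarC (h h' : hspace met m) : gbar h h' = gbar h' h.
Proof. exact: bary_metricC. Qed.

(** By definition of the kernel, the quotient by it has no radical. *)
Lemma gbar_inj (h h' : hspace met m) :
  (forall x, gbar h x = gbar h' x) -> h = h'.
Proof.
move=> hh'; rewrite -[h]reprK -[h']reprK; apply/quotmod_eqP/asboolP => w.
rewrite bary_metricC addrC -scaleN1r bary_metric_linear.
have gbar_pi x : bary_metric met w (repr x) = gbar x (\pi_(hspace met m) w).
  by rewrite /gbar bary_metric_repr bary_metricC.
by rewrite !gbar_pi hh' mulN1r addNr.
Qed.

(** With [M] the Gram matrix of the spanning family, the coefficients [X] of [h]
    can be replaced by [X *m M *m pinvmx M]: both have the same image under [M],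
    hence the same products with all of [e], so they give the same vector since
    [gbar] has no radical.  The new coefficients depend linearly on [h], because
    [X *m M] lists the products of [h] with [e]; a spanning family thus acquires
    dual covectors without being reduced to a basis. *)
Lemma dual_frame r (e : 'I_r -> hspace met m) :
  (forall h, exists c : 'I_r -> R, h = \sum_i c i *: e i) ->
  exists c : 'I_r -> {scalar hspace met m}, forall h, h = \sum_l c l h *: e l.
Proof.
move=> span; pose M := \matrix_(i, j) gbar (e i) (e j).
exists (fun l => flat (\sum_j pinvmx M j l *: e j)) => h.
have [x hx] := span h.
pose X := \row_i x i; pose y := X *m M *m pinvmx M.
have gbarDl (z : 'I_r -> R) h' :
    gbar (\sum_i z i *: e i) h' = \sum_i z i * gbar (e i) h'.
  rewrite gbarC linear_sum; apply: eq_bigr => i _.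
  by rewrite linearZ /= gbarC.
have XM j : (X *m M) 0 j = gbar h (e j).
  by rewrite hx gbarDl mxE; apply: eq_bigr => i _; rewrite !mxE.
have yE l : flat (\sum_j pinvmx M j l *: e j) h = y 0 l.
  rewrite /flat /= gbarDl /y mxE; apply: eq_bigr => j _.
  by rewrite XM mulrC gbarC.
under eq_bigr do rewrite yE.
apply: gbar_inj => x'; have [z ->] := span x'.
rewrite !linear_sum; apply: eq_bigr => j _; rewrite !linearZ /= -XM gbarDl.
congr (_ * _); have -> : X *m M = y *m M by rewrite /y mulmxKpV// submxMl.
by rewrite mxE; apply: eq_bigr => i _; rewrite !mxE.
Qed.

Lemma form_on_hspace_decomposable r (e : 'I_r -> hspace met m) k
    (omega : preform R (esph G) k) :
  (forall h, exists c : 'I_r -> R, h = \sum_i c i *: e i) ->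
  horizontal met omega ->
  decomposable (fun h : 'I_k -> hspace met m => form_on_hspace omega h).
Proof.
move=> /dual_frame[c frame] ho; apply: (alternating_decomposable frame).
  exact: form_on_hspace_multilinear.
exact: form_on_hspace_alternating.
Qed.

Hypothesis nondeg : bijective (@flat _ _ met _ m).

Lemma flat_sharp (a : {scalar hspace met m}) : flat (sharp a) = a.
Proof.
rewrite /sharp; have [g _ gK] := nondeg.
by apply: (@xgetPex _ 0 [set h | flat h = a]); exists (g a).
Qed.

Lemma inner_dualE (a b : {scalar hspace met m}) : inner_dual a b = a (sharp b).
Proof. by rewrite -[in RHS](flat_sharp a). Qed.

Lemma inner_dualC (a b : {scalar hspace met m}) :
  inner_dual a b = inner_dual b a.
Proof. exact: gbarC. Qed.

End Fiber.
End HorizontalForms.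

(** * The pairing and the Laplacian *)

Section Pairing.
Variables (R : realType) (G : lieGroup R) (met : invariant_metric G).
Variables (J : Type) (I_ : J -> {fset nat}).
Hypothesis hrank : forall j, finite_rank met (I_ j).
Hypothesis hnondeg : forall j, strongly_nondegenerate met (I_ j).

Lemma horizontal_decomposable k (omega : preform R (esph G) k) j
    (m : local_model G (I_ j)) : horizontal met omega ->
  decomposable (fun h : 'I_k -> hspace met m => form_on_hspace omega h).
Proof.
have [r [e span]] := hrank j.
exact: form_on_hspace_decomposable (span m).
Qed.

Lemma integrandC k (alpha beta : preform R (esph G) k) :
  horizontal met alpha -> horizontal met beta ->
  integrand met alpha beta = integrand met beta alpha :> lm_functions G I_.
Proof.
move=> ha hb; apply: functional_extensionality_dep => j; apply/funext => m.
apply: (ext_pairingC (sh := @sharp _ _ met _ m)).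
- exact: inner_dualE (hnondeg m).
- exact: inner_dualC.
- exact: horizontal_decomposable.
- exact: horizontal_decomposable.
Qed.

(** The factor 1 gives the right-hand side the shape of [int_dom_linear]. *)
Lemma integrandDl k (alpha alpha' beta : preform R (esph G) k) :
  horizontal met alpha -> horizontal met alpha' -> horizontal met beta ->
  integrand met (addform alpha alpha') beta =
  (fun j m => 1 * integrand met alpha beta m + integrand met alpha' beta m)
  :> lm_functions G I_.
Proof.
move=> ha ha' hb; apply: functional_extensionality_dep => j; apply/funext => m.
rewrite mul1r; apply: (ext_pairingDl (sh := @sharp _ _ met _ m)).
- exact: inner_dualE (hnondeg m).
- exact: inner_dualC.
- exact: horizontal_decomposable.
- exact: horizontal_decomposable.
- exact: horizontal_decomposable (horizontal_addform ha ha').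
- exact: horizontal_decomposable.
Qed.

Variable mu : integration G I_.

Lemma pairingC k (alpha beta : preform R (esph G) k) :
  horizontal met alpha -> horizontal met beta ->
  (paired met mu alpha beta <-> paired met mu beta alpha) /\
  pairing met mu alpha beta = pairing met mu beta alpha.
Proof. by move=> ha hb; rewrite /paired /pairing integrandC. Qed.

Lemma pairingDl k (alpha alpha' beta : preform R (esph G) k) :
  horizontal met alpha -> horizontal met alpha' -> horizontal met beta ->
  paired met mu alpha beta -> paired met mu alpha' beta ->
  paired met mu (addform alpha alpha') beta /\
  pairing met mu (addform alpha alpha') beta =
  pairing met mu alpha beta + pairing met mu alpha' beta.
Proof.
move=> ha ha' hb pa pa'; rewrite /paired /pairing integrandDl//.
by split; [exact: int_dom_linear|rewrite int_val_linear// mul1r].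
Qed.

Variables (A : forall k, set (preform R (esph G) k)).
Variable delta : forall k, preform R (esph G) k.+1 -> preform R (esph G) k.
Hypotheses (hA : admissible met A).
Hypothesis hdelta : forall k (beta : preform R (esph G) k.+1),
  horizontal met beta -> horizontal met (delta beta).
Hypothesis hadj : formal_adjoint met mu A delta.

Lemma laplacian_horizontal k (alpha : preform R (esph G) k) :
  laplacian_dom delta A alpha -> horizontal met (laplacian delta alpha).
Proof.
case: k alpha => [|k] alpha /=.
  by move=> [_ /hA[hda _]]; exact: hdelta.
move=> [_ /hA[hda _] /hA[_ hdd]]; apply: horizontal_addform => //.
exact: hdelta.
Qed.

(** The quadratic form of the Laplacian; [delta] does not exist in degree 0. *)
Definition dirichlet k : preform R (esph G) k -> preform R (esph G) k -> R :=
  match k with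
  | 0 => fun alpha beta => pairing met mu (esph_d alpha) (esph_d beta)
  | k'.+1 => fun alpha beta =>
      pairing met mu (delta alpha) (delta beta) +
      pairing met mu (esph_d alpha) (esph_d beta)
  end.

(** The adjunction has [d] on the left, so [<delta d a, b>] is first turned over. *)
Lemma pairing_delta_d k (alpha beta : preform R (esph G) k) :
  A alpha -> A (esph_d alpha) -> A beta ->
  paired met mu (delta (esph_d alpha)) beta /\
  pairing met mu (delta (esph_d alpha)) beta =
  pairing met mu (esph_d alpha) (esph_d beta).
Proof.
move=> Aa Ada Ab; have [hb hdb] := hA Ab; have [hda _] := hA Ada.
have [_ p2 e] := hadj Ab Ada; have [pC eC] := pairingC (hdelta hda) hb.
have [_ eC'] := pairingC hda hdb.
by split; [exact/pC|rewrite eC -e].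
Qed.

Lemma pairing_laplacian k (alpha beta : preform R (esph G) k) :
  laplacian_dom delta A alpha -> laplacian_dom delta A beta ->
  paired met mu (laplacian delta alpha) beta /\
  pairing met mu (laplacian delta alpha) beta = dirichlet alpha beta.
Proof.
case: k alpha beta => [|k] alpha beta /=.
  by move=> [Aa Ada] [Ab _]; exact: pairing_delta_d.
move=> [Aa Ada Adla] [Ab _ Adlb].
have [p1 e1] := pairing_delta_d Aa Ada Ab; have [p2 _ e2] := hadj Adla Ab.
have [hda _] := hA Ada; have [_ hdd] := hA Adla; have [hb _] := hA Ab.
have [p ->] := pairingDl hdd (hdelta hda) hb p2 p1.
by rewrite e1 e2.
Qed.

Lemma dirichletC k (alpha beta : preform R (esph G) k) :
  laplacian_dom delta A alpha -> laplacian_dom delta A beta ->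
  dirichlet alpha beta = dirichlet beta alpha.
Proof.
case: k alpha beta => [|k] alpha beta /=.
  by move=> [/hA[_ hda] _] [/hA[_ hdb] _]; have [_] := pairingC hda hdb.
move=> [/hA[_ hda] _ /hA[hla _]] [/hA[_ hdb] _ /hA[hlb _]].
by have [_ ->] := pairingC hda hdb; have [_ ->] := pairingC hla hlb.
Qed.

End Pairing.

Theorem proposition7p15 (R : realType) (G : lieGroup R)
    (met : invariant_metric G) (J : Type) (I_ : J -> {fset nat})
    (hrank : forall j, finite_rank met (I_ j))
    (hnondeg : forall j, strongly_nondegenerate met (I_ j))
    (mu : integration G I_)
    (A : forall k, set (preform R (esph G) k))
    (hA : admissible met A)
    (delta : forall k, preform R (esph G) k.+1 -> preform R (esph G) k)
    (hdelta : forall k (beta : preform R (esph G) k.+1),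
        horizontal met beta -> horizontal met (delta k beta))
    (hadj : formal_adjoint met mu A delta) (k : nat) :
  (forall alpha : preform R (esph G) k,
     laplacian_dom delta A alpha ->
     horizontal met (laplacian delta alpha)) /\
  (forall alpha beta : preform R (esph G) k,
     laplacian_dom delta A alpha ->
     laplacian_dom delta A beta ->
     [/\ paired met mu (laplacian delta alpha) beta,
         paired met mu alpha (laplacian delta beta) &
         pairing met mu (laplacian delta alpha) beta =
         pairing met mu alpha (laplacian delta beta)]).
Proof.
split=> [alpha|alpha beta da db]; first exact: laplacian_horizontal.
have lap := pairing_laplacian hrank hnondeg hA hdelta hadj.
have [pab eab] := lap _ _ _ da db; have [pba eba] := lap _ _ _ db da.
have ha : horizontal met alpha.
  by case: k alpha beta da {db pab eab pba eba} => [|k'] alpha _ [/hA[]].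
have [pC eC] :=
  pairingC hrank hnondeg mu (laplacian_horizontal hA hdelta db) ha.
split=> //; first exact/pC.
by rewrite eab -eC eba (dirichletC hrank hnondeg mu hA da db).
Qed.
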